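(* Let $q>1$ be real and let $P_0(q)$ be the explicit threshold defined in the context. Then for every odd prime $p\ge P_0(q)$, $$\mathfrak F^{\sharp}(x,q)>0\quad\text{for all }x\in(p-1,p),\qquad\text{and}\qquad \mathfrak F^{\sharp}(p,q)=0.$$ In particular, $(p-1,p)$ is free of real zeros of $\mathfrak F^{\sharp}(\cdot,q)$ for all odd primes $p\ge P_0(q)$.
   Context: For $z\in\mathbb C$ and an integer $i\ge2$, $F(z,i)=i+2\sum_{k=1}^{i-1}(i-k)\cos(2\pi kz/i)$ and $\phi_i(z)=F(z,i)/i^2$. For $q>1$ and $x\in\mathbb R$ put $S_q(x)=\sum_{i\ge2}q^{-i}\phi_i(x)$, $S_1(x)=\frac{\sin(2\pi x)}{2\pi}$, and $$\mathfrak F^{\sharp}(x,q)=(q-1)q\Big(S_q(x)-q^{-x}\bigl(1+(\log q)S_1(x)\bigr)\Big).$$ Threshold. Put $\lambda=\log q$ and $$\Sigma(q)=\sum_{i\ge2}\frac{q^{-i}}{i^2},\qquad \Lambda_{\sin}(q)=1+\frac{\log q}{2\pi},$$ $$C'_{\sin}(q)=\frac12\Big(\tfrac{\pi^2}{2}q^{-2}+\tfrac{8\pi^2}{27}q^{-3}+\tfrac{\pi^2}{4}q^{-4}-\big(\tfrac{2\pi^2}{3}+(\log q)^2\big)q^{-5}\Big),\qquad K_0(q)=\tfrac12C'_{\sin}(q),$$ $$C_3^{\mathrm{tot}}(q)=4\pi^3\,\frac{q^{-2}}{1-1/q}+\lambda^3\Bigl(4+\frac{\lambda}{2\pi}\Bigr)+6\pi\lambda^2+4\pi^2\lambda,$$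 $$\delta_{\sin}(q)=\min\Bigl\{1,\frac{3K_0(q)}{C_3^{\mathrm{tot}}(q)}\Bigr\},\qquad \alpha(q)=\min\Big\{\frac14,\frac{\delta_{\sin}(q)}{2}\Big\},$$ $$P_0(q)=\max\left\{3+\frac{\log\!\Big(\frac{\Lambda_{\sin}(q)}{\cos^2(\pi\alpha(q)/2)}\Big)}{\log q},\ 1+\alpha(q)+\frac{\log\!\Big(\frac{\Lambda_{\sin}(q)}{\sin^2(\pi\alpha(q))\,\Sigma(q)}\Big)}{\log q},\ 5\right\}.$$ *)

(* Defs.v *)
From Stdlib Require Import Reals ZArith Znumtheory.
From Coquelicot Require Import Coquelicot.
Open Scope R_scope.

(* The cosine sum is only ever evaluated at real points, so its argument is
   taken real throughout. *)
Definition F (z : R) (i : nat) : R :=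
  INR i
  + 2 * sum_n_m (fun k : nat =>
                   (INR i - INR k) * cos (2 * PI * INR k * z / INR i))
                1 (i - 1).

Definition phi (i : nat) (z : R) : R := F z i / INR i ^ 2.

(* [Series] sums from 0: a sum over i >= 2 is written with i = n + 2. *)
Definition S_q (q x : R) : R :=
  Series (fun n : nat => / q ^ (n + 2) * phi (n + 2) x).

Definition S_1 (x : R) : R := sin (2 * PI * x) / (2 * PI).

Definition Fsharp (x q : R) : R :=
  (q - 1) * q * (S_q q x - Rpower q (- x) * (1 + ln q * S_1 x)).

Definition Sigma (q : R) : R :=
  Series (fun n : nat => / q ^ (n + 2) / INR (n + 2) ^ 2).

Definition Lambda_sin (q : R) : R := 1 + ln q / (2 * PI).

Definition C'_sin (q : R) : R :=
  1 / 2 * (PI ^ 2 / 2 * / q ^ 2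
           + 8 * PI ^ 2 / 27 * / q ^ 3
           + PI ^ 2 / 4 * / q ^ 4
           - (2 * PI ^ 2 / 3 + ln q ^ 2) * / q ^ 5).

Definition K_0 (q : R) : R := 1 / 2 * C'_sin q.

Definition C_3_tot (q : R) : R :=
  4 * PI ^ 3 * (/ q ^ 2 / (1 - 1 / q))
  + ln q ^ 3 * (4 + ln q / (2 * PI))
  + 6 * PI * ln q ^ 2
  + 4 * PI ^ 2 * ln q.

Definition delta_sin (q : R) : R := Rmin 1 (3 * K_0 q / C_3_tot q).

Definition alpha (q : R) : R := Rmin (1 / 4) (delta_sin q / 2).

Definition P_0 (q : R) : R :=
  Rmax (3 + ln (Lambda_sin q / cos (PI * alpha q / 2) ^ 2) / ln q)
    (Rmax (1 + alpha q
           + ln (Lambda_sin q / (sin (PI * alpha q) ^ 2 * Sigma q)) / ln q)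
       5).

(* Main.v *)
Require Import Defs.
From Stdlib Require Import Reals ZArith Znumtheory Lra Lia.
From Coquelicot Require Import Coquelicot.
Open Scope R_scope.

(** Each [phi i] is a Fejer kernel,
    [phi i x = (sin (PI x) / (i sin (PI x / i)))^2], so it lies in [[0, 1]], is
    at least [sin (PI x)^2 / i^2], and at an integer [n] equals 1 or 0 according
    to whether [i] divides [n].  At a prime [p] only the term [i = p] of [S_q]
    survives, so [S_q p = q^(-p)]; since [S_1 p = 0] this gives [Fsharp p = 0]
    ([Fsharp_prime]).

    On [(p - 1, p)] the value [S_q x] has to beat
    [q^(-x) (1 + ln q * S_1 x)], which is at most [Lambda_sin q * q^(-x)].
    Write [a = alpha q], which lies in [(0, 1/4]].

    - On [(p - 1, p - 1 + a]] the point is close to an even integer, where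
      [phi 2] is close to 1: the single term [q^(-2) phi 2 x] is at least
      [q^(-2) cos (PI a / 2)^2], and the first entry of [P_0] makes this
      dominate ([Fsharp_pos_left]).
    - On [[p - 1 + a, p - a]] all terms together give at least
      [sin (PI a)^2 * Sigma q], and the second entry of [P_0] makes this
      dominate ([Fsharp_pos_middle]).
    - On [(p - a, p)] both sides tend to [q^(-p)] at [p], and the comparison is
      of second order in [y = PI (p - x)].  After multiplication by [q^p], the
      term [i = p] contributes at least [1 - y^2 / 3], while the term
      subtracted is at most [1 + y^2 q (q - 1) / 6]: the slope [ln q] of
      [q^(p-x)] is cancelled by that of [1 + ln q * S_1].  The loss of order [y^2] is made
      up by the terms [i = 2, 3, 4], whose weights [q^(p-i)] are at least
      [q^(5-i)] because [p >= 5].  These explicit bounds hold for all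
      [p - x <= 1/4] ([Fsharp_pos_right]). *)

(** * The Fejer kernel *)

Definition dirichlet (t : R) (n : nat) : R :=
  1 + 2 * sum_n_m (fun k => cos (INR k * t)) 1 n.

(** The summation runs up to [n] although the last term vanishes: then the
    sum for [S n] and the sum for [n] differ by a Dirichlet kernel term by
    term. *)
Definition fejer (t : R) (n : nat) : R :=
  INR n + 2 * sum_n_m (fun k => (INR n - INR k) * cos (INR k * t)) 1 n.

Lemma fejer_0 (t : R) : fejer t 0 = 0.
Proof.
  unfold fejer; rewrite sum_n_m_zero by lia; unfold zero; simpl; ring.
Qed.

Lemma dirichlet_0 (t : R) : dirichlet t 0 = 1.
Proof.
  unfold dirichlet; rewrite sum_n_m_zero by lia; unfold zero; simpl; ring.
Qed.

Lemma dirichlet_S (t : R) (n : nat) :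
  dirichlet t (S n) = dirichlet t n + 2 * cos (INR (S n) * t).
Proof.
  unfold dirichlet; rewrite sum_n_Sm by lia; unfold plus; simpl plus; cbn -[INR].
  ring.
Qed.

Lemma fejer_S (t : R) (n : nat) : fejer t (S n) = fejer t n + dirichlet t n.
Proof.
  unfold fejer, dirichlet.
  rewrite sum_n_Sm by lia.
  rewrite (sum_n_m_ext _ (fun k => plus ((INR n - INR k) * cos (INR k * t))
                                        (cos (INR k * t)))).
  2: { intros k; unfold plus; cbn -[INR]; rewrite S_INR; ring. }
  rewrite sum_n_m_plus; unfold plus; cbn -[INR]; rewrite S_INR; ring.
Qed.

Lemma F_fejer (z : R) (i : nat) : F z i = fejer (2 * PI * z / INR i) i.
Proof.
  unfold F, fejer; destruct i as [|i].
  - now rewrite !sum_n_m_zero by lia.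
  - replace (S i - 1)%nat with i by lia.
    rewrite (sum_n_Sm _ 1 i) by lia.
    replace ((INR (S i) - INR (S i)) * cos (INR (S i) * (2 * PI * z / INR (S i))))
      with (@zero R_AbelianMonoid) by (unfold zero; cbn -[INR]; ring).
    rewrite plus_zero_r; do 2 f_equal.
    apply sum_n_m_ext; intros k; do 2 f_equal.
    field; apply not_0_INR; lia.
Qed.

Lemma dirichlet_sin (h : R) (n : nat) :
  dirichlet (2 * h) n * sin h = sin (INR (2 * n + 1) * h).
Proof.
  induction n as [|n IH].
  - rewrite dirichlet_0; simpl; f_equal; ring_simplify; f_equal; ring.
  - rewrite dirichlet_S, Rmult_plus_distr_r, IH.
    replace (INR (2 * n + 1) * h) with (INR (S n) * (2 * h) - h)
      by (rewrite plus_INR, mult_INR, S_INR; simpl; ring).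
    replace (INR (2 * S n + 1) * h) with (INR (S n) * (2 * h) + h)
      by (rewrite plus_INR, mult_INR, S_INR; simpl; ring).
    rewrite sin_plus, sin_minus; ring.
Qed.

(** Telescoping: [sin ((2n+1) h) * sin h = sin ((n+1) h)^2 - sin (n h)^2]. *)
Lemma fejer_sin (h : R) (n : nat) :
  fejer (2 * h) n * sin h ^ 2 = sin (INR n * h) ^ 2.
Proof.
  induction n as [|n IH].
  - rewrite fejer_0; change (INR 0) with 0; rewrite !Rmult_0_l, sin_0; ring.
  - rewrite fejer_S, Rmult_plus_distr_r, IH.
    replace (dirichlet (2 * h) n * sin h ^ 2)
      with (dirichlet (2 * h) n * sin h * sin h) by ring.
    rewrite dirichlet_sin.
    replace (INR (2 * n + 1) * h) with (INR n * h + INR (S n) * h)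
      by (rewrite plus_INR, mult_INR, S_INR; simpl; ring).
    replace (sin h) with (sin (INR (S n) * h - INR n * h))
      by (f_equal; rewrite S_INR; ring).
    rewrite sin_plus, sin_minus.
    pose proof (sin2_cos2 (INR n * h)) as H1.
    pose proof (sin2_cos2 (INR (S n) * h)) as H2.
    unfold Rsqr in H1, H2.
    set (a := sin (INR n * h)) in *; set (b := cos (INR n * h)) in *.
    set (c := sin (INR (S n) * h)) in *; set (d := cos (INR (S n) * h)) in *.
    transitivity (a ^ 2 + (c * c * (b * b) - a * a * (d * d))); [ring|].
    replace (b * b) with (1 - a * a) by lra.
    replace (d * d) with (1 - c * c) by lra.
    ring.
Qed.

Lemma dirichlet_le (t : R) (n : nat) : dirichlet t n <= 2 * INR n + 1.
Proof.
  induction n as [|n IH].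
  - rewrite dirichlet_0; simpl; lra.
  - rewrite dirichlet_S, S_INR.
    pose proof (COS_bound ((INR n + 1) * t)); lra.
Qed.

Lemma fejer_le (t : R) (n : nat) : fejer t n <= INR n ^ 2.
Proof.
  induction n as [|n IH].
  - rewrite fejer_0; simpl; lra.
  - rewrite fejer_S, S_INR; pose proof (dirichlet_le t n); nra.
Qed.

(** The removable singularity of the quotient [sin (n h)^2 / sin h^2]. *)
Lemma fejer_sin0 (h : R) (n : nat) :
  sin h = 0 -> fejer (2 * h) n = INR n ^ 2.
Proof.
  intros Hh.
  assert (Hs : forall k, sin (INR k * h) = 0).
  { intros k; induction k as [|k IH].
    - change (INR 0) with 0; rewrite Rmult_0_l; apply sin_0.
    - rewrite S_INR, Rmult_plus_distr_r, Rmult_1_l, sin_plus, IH, Hh; ring. }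
  assert (Hd : forall k, dirichlet (2 * h) k = 2 * INR k + 1).
  { intros k; induction k as [|k IH].
    - rewrite dirichlet_0; simpl; ring.
    - rewrite dirichlet_S, IH.
      replace (INR (S k) * (2 * h)) with (2 * (INR (S k) * h)) by ring.
      rewrite cos_2a_sin, Hs, S_INR; ring. }
  induction n as [|n IH].
  - rewrite fejer_0; simpl; ring.
  - rewrite fejer_S, IH, Hd, S_INR; ring.
Qed.

(** Follows from [fejer_sin] because the factor [sin h ^ 2] is at most 1; only
    the points where it vanishes need the explicit value. *)
Lemma fejer_ge (h : R) (n : nat) : sin (INR n * h) ^ 2 <= fejer (2 * h) n.
Proof.
  pose proof (fejer_sin h n) as E.
  destruct (Req_dec (sin h) 0) as [H0|H0].
  - rewrite H0 in E; rewrite (fejer_sin0 h n H0).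
    pose proof (pow2_ge_0 (INR n)); nra.
  - pose proof (SIN_bound h) as B.
    assert (0 < sin h ^ 2 <= 1).
    { split; [apply pow2_gt_0, H0 | nra]. }
    pose proof (pow2_ge_0 (sin (INR n * h))).
    destruct (Rle_lt_dec 0 (fejer (2 * h) n)); nra.
Qed.

(** * The functions phi *)

Lemma INR_add2_pos (n : nat) : 0 < INR (n + 2).
Proof. apply lt_0_INR; lia. Qed.

Lemma F_half (z : R) (i : nat) : F z i = fejer (2 * (PI * z / INR i)) i.
Proof. rewrite F_fejer; f_equal; unfold Rdiv; ring. Qed.

Lemma phi_ge (i : nat) (z : R) :
  (0 < i)%nat -> sin (PI * z) ^ 2 / INR i ^ 2 <= phi i z.
Proof.
  intros Hi; pose proof (lt_0_INR i Hi) as Hp.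
  unfold phi, Rdiv; apply Rmult_le_compat_r.
  - apply Rlt_le, Rinv_0_lt_compat, pow_lt, Hp.
  - rewrite F_half.
    replace (PI * z) with (INR i * (PI * z / INR i)) by (field; lra).
    replace (INR i * (PI * z / INR i) / INR i) with (PI * z / INR i)
      by (field; lra).
    apply fejer_ge.
Qed.

Lemma phi_nonneg (i : nat) (z : R) : (0 < i)%nat -> 0 <= phi i z.
Proof.
  intros Hi; eapply Rle_trans; [|apply phi_ge, Hi].
  apply Rdiv_le_0_compat; [apply pow2_ge_0 | apply pow_lt, lt_0_INR, Hi].
Qed.

Lemma phi_le_1 (i : nat) (z : R) : (0 < i)%nat -> phi i z <= 1.
Proof.
  intros Hi; pose proof (pow_lt _ 2 (lt_0_INR i Hi)) as Hp.
  unfold phi; apply Rle_div_l; [exact Hp|].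
  rewrite F_half, Rmult_1_l; apply fejer_le.
Qed.

Lemma phi_sin (i : nat) (z : R) :
  (0 < i)%nat ->
  phi i z * (INR i * sin (PI * z / INR i)) ^ 2 = sin (PI * z) ^ 2.
Proof.
  intros Hi; pose proof (lt_0_INR i Hi) as Hp.
  unfold phi; rewrite F_half.
  pose proof (fejer_sin (PI * z / INR i) i) as E.
  replace (INR i * (PI * z / INR i)) with (PI * z) in E by (field; lra).
  rewrite <- E; field; lra.
Qed.

(** Equal to [cos (PI z / 2)^2]: 1 at even integers, 0 at odd ones. *)
Lemma phi_2 (z : R) : phi 2 z = (1 + cos (PI * z)) / 2.
Proof.
  unfold phi, F; simpl (2 - 1)%nat; rewrite sum_n_n; simpl INR.
  replace (2 * PI * 1 * z / (1 + 1)) with (PI * z) by field.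
  field.
Qed.

Lemma sin_PI_INR (m : nat) : sin (PI * INR m) = 0.
Proof.
  apply sin_eq_0_1; exists (Z.of_nat m); rewrite <- INR_IZR_INZ; ring.
Qed.

Lemma sin_sq_PI_sub (m : nat) (u : R) :
  sin (PI * (INR m - u)) ^ 2 = sin (PI * u) ^ 2.
Proof.
  pose proof (sin2_cos2 (PI * INR m)) as E; unfold Rsqr in E.
  rewrite Rmult_minus_distr_l, sin_minus.
  rewrite sin_PI_INR in E |- *.
  transitivity (cos (PI * INR m) * cos (PI * INR m) * sin (PI * u) ^ 2); [ring|].
  replace (cos (PI * INR m) * cos (PI * INR m)) with 1 by lra; ring.
Qed.

Lemma phi_self (m : nat) : (0 < m)%nat -> phi m (INR m) = 1.
Proof.
  intros Hm; pose proof (lt_0_INR m Hm) as Hp.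
  unfold phi; rewrite F_half, fejer_sin0.
  - field; lra.
  - replace (PI * INR m / INR m) with PI by (field; lra); apply sin_PI.
Qed.

(** The numerator [sin (PI m)] vanishes, whereas [sin (PI m / i) = 0] would
    make [i] a divisor of [m]. *)
Lemma phi_prime (i m : nat) :
  prime (Z.of_nat m) -> (2 <= i)%nat -> i <> m -> phi i (INR m) = 0.
Proof.
  intros Hm Hi Hne.
  assert (Hp : 0 < INR i) by (apply lt_0_INR; lia).
  pose proof (phi_sin i (INR m) ltac:(lia)) as E.
  rewrite sin_PI_INR in E.
  destruct (Req_dec (sin (PI * INR m / INR i)) 0) as [H0|H0].
  - exfalso.
    destruct (sin_eq_0_0 _ H0) as [k Hk].
    assert (HR : IZR (Z.of_nat m) = IZR (k * Z.of_nat i)).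
    { rewrite mult_IZR, <- !INR_IZR_INZ.
      apply (Rmult_eq_reg_l (PI / INR i)).
      - transitivity (PI * INR m / INR i); [field; lra|].
        rewrite Hk; field; lra.
      - apply Rgt_not_eq, Rdiv_lt_0_compat; [apply PI_RGT_0 | exact Hp]. }
    apply eq_IZR in HR.
    destruct (prime_divisors _ Hm (Z.of_nat i)) as [A|[A|[A|A]]];
      try lia; exists k; exact HR.
  - apply (Rmult_eq_reg_r ((INR i * sin (PI * INR m / INR i)) ^ 2)).
    + rewrite E; ring.
    + apply pow_nonzero, Rmult_integral_contrapositive_currified; [lra|exact H0].
Qed.

(** * Lower bounds for the series *)

Lemma ex_series_geom2 (q : R) :
  1 < q -> ex_series (fun n : nat => / q ^ (n + 2)).
Proof.
  intros hq.
  apply (ex_series_ext (fun n => / q ^ 2 * (/ q) ^ n)).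
  - intros n; rewrite pow_add, Rinv_mult, pow_inv; cbn; ring.
  - apply (ex_series_scal_l (/ q ^ 2) (fun n => (/ q) ^ n)).
    apply ex_series_geom.
    rewrite Rabs_pos_eq; [|apply Rlt_le, Rinv_0_lt_compat; lra].
    rewrite <- Rinv_1; apply Rinv_lt_contravar; lra.
Qed.

Lemma ex_series_weighted (q : R) (a : nat -> R) :
  1 < q -> (forall n, 0 <= a n <= 1) ->
  ex_series (fun n : nat => / q ^ (n + 2) * a n).
Proof.
  intros hq Ha.
  apply (ex_series_le (V := R_CompleteNormedModule) _ (fun n => / q ^ (n + 2)));
    [|apply ex_series_geom2, hq].
  intros n; change norm with Rabs; cbn.
  assert (0 < / q ^ (n + 2)) by (apply Rinv_0_lt_compat, pow_lt; lra).
  specialize (Ha n); rewrite Rabs_pos_eq; nra.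
Qed.

Lemma S_q_term_nonneg (q x : R) (n : nat) :
  1 < q -> 0 <= / q ^ (n + 2) * phi (n + 2) x.
Proof.
  intros hq; apply Rmult_le_pos.
  - apply Rlt_le, Rinv_0_lt_compat, pow_lt; lra.
  - apply phi_nonneg; lia.
Qed.

Lemma ex_S_q (q x : R) :
  1 < q -> ex_series (fun n : nat => / q ^ (n + 2) * phi (n + 2) x).
Proof.
  intros hq.
  apply (ex_series_weighted q (fun n => phi (n + 2) x) hq).
  intros n; split; [apply phi_nonneg | apply phi_le_1]; lia.
Qed.

Lemma Series_zero (a : nat -> R) : (forall n, a n = 0) -> Series a = 0.
Proof.
  intros Ha; rewrite (Series_ext a (fun n => 0 * a n)).
  - rewrite Series_scal_l; ring.
  - intros n; rewrite Ha; ring.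
Qed.

Lemma Series_nonneg (a : nat -> R) :
  (forall n, 0 <= a n) -> ex_series a -> 0 <= Series a.
Proof.
  intros Ha Hex.
  rewrite <- (Series_zero (fun _ => 0)) by reflexivity.
  apply Series_le; [|exact Hex].
  intros n; split; [lra | apply Ha].
Qed.

Lemma Series_ge_term (a : nat -> R) (N : nat) :
  (forall n, 0 <= a n) -> ex_series a -> a N <= Series a.
Proof.
  revert a; induction N as [|N IH]; intros a Ha Hex.
  - rewrite Series_incr_1 by exact Hex.
    pose proof (Series_nonneg (fun k => a (S k)) (fun k => Ha (S k))
                  (proj1 (ex_series_incr_1 a) Hex)); lra.
  - rewrite Series_incr_1 by exact Hex.
    pose proof (IH (fun k => a (S k)) (fun k => Ha (S k))
                  (proj1 (ex_series_incr_1 a) Hex)).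
    specialize (Ha O); cbn in *; lra.
Qed.

Lemma Series_single (a : nat -> R) (N : nat) :
  ex_series a -> (forall n, n <> N -> a n = 0) -> Series a = a N.
Proof.
  revert a; induction N as [|N IH]; intros a Hex Ha;
    rewrite Series_incr_1 by exact Hex.
  - rewrite (Series_zero (fun k => a (S k))); [ring|].
    intros n; apply Ha; lia.
  - rewrite Ha by lia.
    rewrite (IH (fun k => a (S k))); [ring| |].
    + apply (proj1 (ex_series_incr_1 a) Hex).
    + intros n Hn; apply Ha; lia.
Qed.

(** The terms that matter near the prime [m]: [m] itself carries the main part,
    and 2, 3, 4 do not divide it and have the largest weights.  For [m >= 5]
    the four are distinct. *)
Lemma S_q_ge_terms (q x : R) (m : nat) :
  1 < q -> (5 <= m)%nat ->
  / q ^ 2 * phi 2 x + / q ^ 3 * phi 3 x + / q ^ 4 * phi 4 x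
  + / q ^ m * phi m x <= S_q q x.
Proof.
  intros hq Hm; unfold S_q.
  set (a := fun n : nat => / q ^ (n + 2) * phi (n + 2) x).
  assert (H0 : ex_series a) by (apply ex_S_q, hq).
  pose proof (proj1 (ex_series_incr_1 a) H0) as H1.
  pose proof (proj1 (ex_series_incr_1 _) H1) as H2.
  pose proof (proj1 (ex_series_incr_1 _) H2) as H3.
  rewrite Series_incr_1 by exact H0.
  rewrite Series_incr_1 by exact H1.
  rewrite Series_incr_1 by exact H2.
  assert (Hge : / q ^ m * phi m x <= Series (fun k => a (S (S (S k))))).
  { replace m with (S (S (S (m - 5))) + 2)%nat by lia.
    apply (Series_ge_term (fun k => a (S (S (S k))))); [|exact H3].
    intros n; apply S_q_term_nonneg, hq. }
  change (a 0%nat) with (/ q ^ 2 * phi 2 x).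
  change (a 1%nat) with (/ q ^ 3 * phi 3 x).
  change (a 2%nat) with (/ q ^ 4 * phi 4 x).
  lra.
Qed.

Lemma S_q_ge_phi_2 (q x : R) : 1 < q -> / q ^ 2 * phi 2 x <= S_q q x.
Proof.
  intros hq.
  apply (Series_ge_term (fun n : nat => / q ^ (n + 2) * phi (n + 2) x) 0).
  - intros n; apply S_q_term_nonneg, hq.
  - apply ex_S_q, hq.
Qed.

Lemma S_q_ge_Sigma (q x : R) :
  1 < q -> sin (PI * x) ^ 2 * Sigma q <= S_q q x.
Proof.
  intros hq; unfold Sigma, S_q; rewrite <- Series_scal_l.
  apply Series_le; [|apply ex_S_q, hq].
  intros n.
  assert (Hq : 0 < / q ^ (n + 2)) by (apply Rinv_0_lt_compat, pow_lt; lra).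
  pose proof (pow_lt _ 2 (INR_add2_pos n)) as Hp.
  pose proof (pow2_ge_0 (sin (PI * x))) as Hs.
  split.
  - apply Rmult_le_pos; [exact Hs|].
    apply Rdiv_le_0_compat; [lra|exact Hp].
  - pose proof (phi_ge (n + 2) x ltac:(lia)) as H.
    replace (sin (PI * x) ^ 2 * (/ q ^ (n + 2) / INR (n + 2) ^ 2))
      with (/ q ^ (n + 2) * (sin (PI * x) ^ 2 / INR (n + 2) ^ 2))
      by (unfold Rdiv; ring).
    apply Rmult_le_compat_l; lra.
Qed.

Lemma Sigma_pos (q : R) : 1 < q -> 0 < Sigma q.
Proof.
  intros hq.
  set (a := fun n : nat => / q ^ (n + 2) / INR (n + 2) ^ 2).
  assert (Ha : forall n, 0 < a n).
  { intros n; apply Rdiv_lt_0_compat.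
    - apply Rinv_0_lt_compat, pow_lt; lra.
    - apply pow_lt, INR_add2_pos. }
  apply Rlt_le_trans with (a O); [apply Ha|].
  apply (Series_ge_term a 0); [intros n; apply Rlt_le, Ha|].
  apply (ex_series_weighted q (fun n => / INR (n + 2) ^ 2) hq).
  intros n; split.
  - apply Rlt_le, Rinv_0_lt_compat, pow_lt, INR_add2_pos.
  - rewrite <- Rinv_1; apply Rinv_le_contravar; [lra|].
    apply pow_R1_Rle; rewrite plus_INR; pose proof (pos_INR n); simpl; lra.
Qed.

Lemma S_q_prime (q : R) (m : nat) :
  1 < q -> prime (Z.of_nat m) -> S_q q (INR m) = / q ^ m.
Proof.
  intros hq Hm; pose proof (prime_ge_2 _ Hm) as H2.
  unfold S_q; rewrite (Series_single _ (m - 2)).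
  - replace (m - 2 + 2)%nat with m by lia.
    rewrite phi_self by lia; ring.
  - apply ex_S_q, hq.
  - intros n Hn; rewrite (phi_prime (n + 2) m Hm) by lia; ring.
Qed.

Lemma S_1_INR (m : nat) : S_1 (INR m) = 0.
Proof.
  unfold S_1; replace (2 * PI * INR m) with (PI * INR (2 * m))
    by (rewrite mult_INR; simpl; ring).
  rewrite sin_PI_INR; unfold Rdiv; ring.
Qed.

Lemma Fsharp_prime (q : R) (m : nat) :
  1 < q -> prime (Z.of_nat m) -> Fsharp (INR m) q = 0.
Proof.
  intros hq Hm; unfold Fsharp.
  rewrite S_q_prime, S_1_INR, Rpower_Ropp, Rpower_pow by (assumption || lra).
  ring.
Qed.

(** * The parameters of the threshold *)

Lemma ln_le_sub (q : R) : 0 < q -> ln q <= q - 1.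
Proof.
  intros hq; pose proof (exp_ineq1_le (ln q)) as H.
  rewrite exp_ln in H; lra.
Qed.

Lemma ln_gt_0 (q : R) : 1 < q -> 0 < ln q.
Proof. intros hq; rewrite <- ln_1; apply ln_increasing; lra. Qed.

Lemma Lambda_sin_pos (q : R) : 1 < q -> 0 < Lambda_sin q.
Proof.
  intros hq; unfold Lambda_sin.
  assert (0 < ln q / (2 * PI)); [|lra].
  apply Rdiv_lt_0_compat; [apply ln_gt_0, hq | pose proof PI_RGT_0; lra].
Qed.

Lemma S_1_le_Lambda (q x : R) : 1 < q -> 1 + ln q * S_1 x <= Lambda_sin q.
Proof.
  intros hq; unfold Lambda_sin, S_1.
  pose proof (ln_gt_0 q hq) as Hl; pose proof PI_RGT_0 as Hpi.
  pose proof (SIN_bound (2 * PI * x)).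
  assert (0 < ln q / (2 * PI)) by (apply Rdiv_lt_0_compat; lra).
  replace (ln q * (sin (2 * PI * x) / (2 * PI)))
    with (ln q / (2 * PI) * sin (2 * PI * x)) by (field; lra).
  nra.
Qed.

(** With [PI ^ 2 >= 4] and [ln q <= q - 1] this becomes a polynomial inequality
    in [q]: [(q - 1)^2 < 4 (q^3/2 + 8 q^2/27 + q/4 - 2/3)]. *)
Lemma C'_sin_pos (q : R) : 1 < q -> 0 < C'_sin q.
Proof.
  intros hq; unfold C'_sin.
  pose proof (ln_gt_0 q hq) as Hl; pose proof (ln_le_sub q ltac:(lra)) as Hl'.
  pose proof PI2_1 as Hpi.
  replace (PI ^ 2 / 2 * / q ^ 2 + 8 * PI ^ 2 / 27 * / q ^ 3
           + PI ^ 2 / 4 * / q ^ 4 - (2 * PI ^ 2 / 3 + ln q ^ 2) * / q ^ 5)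
    with ((PI ^ 2 * (q ^ 3 / 2 + 8 * q ^ 2 / 27 + q / 4 - 2 / 3) - ln q ^ 2)
          / q ^ 5) by (field; lra).
  assert (Hn : 0 < PI ^ 2 * (q ^ 3 / 2 + 8 * q ^ 2 / 27 + q / 4 - 2 / 3)
                   - ln q ^ 2).
  { assert (4 <= PI ^ 2) by nra.
    assert (ln q ^ 2 <= (q - 1) ^ 2) by nra.
    assert (0 < q ^ 3 / 2 + 8 * q ^ 2 / 27 + q / 4 - 2 / 3) by nra.
    assert ((q - 1) ^ 2 < 4 * (q ^ 3 / 2 + 8 * q ^ 2 / 27 + q / 4 - 2 / 3))
      by nra.
    nra. }
  pose proof (Rdiv_lt_0_compat _ _ Hn (pow_lt q 5 ltac:(lra))); lra.
Qed.

(** Positivity of [alpha] makes the entries of [P_0] meaningful: the logarithm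
    of a quotient by [sin (PI * alpha q) ^ 2] is involved. *)
Lemma alpha_bounds (q : R) : 1 < q -> 0 < alpha q <= 1 / 4.
Proof.
  intros hq.
  assert (Hc : 0 < C_3_tot q).
  { unfold C_3_tot.
    pose proof (ln_gt_0 q hq) as Hl; pose proof PI_RGT_0 as Hpi.
    assert (0 < 1 - 1 / q).
    { assert (1 / q < 1) by (apply Rlt_div_l; lra); lra. }
    assert (0 < / q ^ 2 / (1 - 1 / q)).
    { apply Rdiv_lt_0_compat; [apply Rinv_0_lt_compat, pow_lt; lra|lra]. }
    assert (0 < ln q / (2 * PI)) by (apply Rdiv_lt_0_compat; lra).
    pose proof (pow_lt PI 3 Hpi); pose proof (pow_lt PI 2 Hpi).
    pose proof (pow_lt _ 3 Hl); pose proof (pow_lt _ 2 Hl).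
    repeat apply Rplus_lt_0_compat; repeat (apply Rmult_lt_0_compat; [|lra]);
      lra. }
  assert (Hd : 0 < delta_sin q).
  { unfold delta_sin; apply Rmin_glb_lt; [lra|].
    pose proof (C'_sin_pos q hq).
    apply Rdiv_lt_0_compat; [unfold K_0; lra | exact Hc]. }
  unfold alpha; split; [apply Rmin_glb_lt; lra | apply Rmin_l].
Qed.

Lemma threshold_le (q c A p : R) :
  1 < q -> 0 < A -> c + ln A / ln q <= p -> A <= Rpower q (p - c).
Proof.
  intros hq HA H; pose proof (ln_gt_0 q hq) as Hl.
  unfold Rpower; rewrite <- (exp_ln A HA) at 1.
  apply Rnot_lt_le; intros Hlt; apply exp_lt_inv, Rlt_div_r in Hlt; lra.
Qed.

(** * Away from the prime *)

Lemma Fsharp_pos_of (q x : R) :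
  1 < q -> Rpower q (- x) * (1 + ln q * S_1 x) < S_q q x -> 0 < Fsharp x q.
Proof.
  intros hq H; unfold Fsharp; repeat apply Rmult_lt_0_compat; lra.
Qed.

(** The strictness of all comparisons away from the prime comes from [d < x]. *)
Lemma main_term_lt (q x d : R) :
  1 < q -> d < x ->
  Rpower q (- x) * (1 + ln q * S_1 x) < Rpower q (- d) * Lambda_sin q.
Proof.
  intros hq Hd.
  pose proof (S_1_le_Lambda q x hq); pose proof (Lambda_sin_pos q hq).
  assert (0 < Rpower q (- x)) by apply exp_pos.
  assert (Rpower q (- x) < Rpower q (- d)) by (apply Rpower_lt; lra).
  nra.
Qed.

(** Since [m - 1] is even, [phi 2] at distance [t] from it is
    [cos (PI t / 2) ^ 2], which decreases in [t]. *)
Lemma Fsharp_pos_left (q t : R) (m : nat) :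
  1 < q -> Nat.Odd m -> P_0 q <= INR m -> 0 < t <= alpha q ->
  0 < Fsharp (INR m - 1 + t) q.
Proof.
  intros hq [k ->] HP Ht.
  pose proof (alpha_bounds q hq) as Ha; pose proof PI_RGT_0 as Hpi.
  set (m := (2 * k + 1)%nat) in *.
  assert (Hc : 0 < cos (PI * alpha q / 2)) by (apply cos_gt_0; nra).
  assert (Hc2 : 0 < cos (PI * alpha q / 2) ^ 2) by (apply pow_lt, Hc).
  pose proof (Lambda_sin_pos q hq) as HL.
  pose proof (Rle_trans _ _ _ (Rmax_l _ _) HP) as H.
  apply threshold_le in H; [|exact hq|apply Rdiv_lt_0_compat; lra].
  apply Rle_div_l in H; [|exact Hc2].
  apply Fsharp_pos_of; [exact hq|].
  eapply Rlt_le_trans; [apply (main_term_lt q _ (INR m - 1) hq); lra|].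
  eapply Rle_trans; [|apply S_q_ge_phi_2, hq].
  eapply Rle_trans.
  { apply Rmult_le_compat_l; [apply Rlt_le, exp_pos | exact H]. }
  rewrite <- Rmult_assoc, <- Rpower_plus.
  replace (- (INR m - 1) + (INR m - 3)) with (- INR 2) by (simpl; ring).
  rewrite Rpower_Ropp, Rpower_pow by lra.
  apply Rmult_le_compat_l.
  { apply Rlt_le, Rinv_0_lt_compat, pow_lt; lra. }
  rewrite phi_2.
  replace (PI * (INR m - 1 + t)) with (2 * (PI * t / 2) + 2 * INR k * PI)
    by (unfold m; rewrite plus_INR, mult_INR; simpl; field).
  rewrite cos_period, cos_2a_cos.
  assert (cos (PI * alpha q / 2) <= cos (PI * t / 2)) by (apply cos_decr_1; nra).
  nra.
Qed.

(** On this range [sin (PI t)] is smallest at the ends, where it is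
    [sin (PI * alpha q)].  The threshold yields a bound at [m - 1 - alpha q],
    and [x] is larger. *)
Lemma Fsharp_pos_middle (q t : R) (m : nat) :
  1 < q -> P_0 q <= INR m -> alpha q <= t <= 1 - alpha q ->
  0 < Fsharp (INR m - 1 + t) q.
Proof.
  intros hq HP Ht.
  pose proof (alpha_bounds q hq) as Ha; pose proof PI_RGT_0 as Hpi.
  assert (Hs : 0 < sin (PI * alpha q)) by (apply sin_gt_0; nra).
  pose proof (Sigma_pos q hq) as HS.
  assert (Hs2 : 0 < sin (PI * alpha q) ^ 2 * Sigma q)
    by (apply Rmult_lt_0_compat; [apply pow_lt, Hs | exact HS]).
  pose proof (Lambda_sin_pos q hq) as HL.
  pose proof (Rle_trans _ _ _ (Rmax_l _ _)
                (Rle_trans _ _ _ (Rmax_r _ _) HP)) as H.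
  apply threshold_le in H; [|exact hq|apply Rdiv_lt_0_compat; lra].
  apply Rle_div_l in H; [|exact Hs2].
  apply Fsharp_pos_of; [exact hq|].
  eapply Rlt_le_trans;
    [apply (main_term_lt q _ (INR m - (1 + alpha q)) hq); lra|].
  eapply Rle_trans; [|apply S_q_ge_Sigma, hq].
  eapply Rle_trans.
  { apply Rmult_le_compat_l; [apply Rlt_le, exp_pos | exact H]. }
  rewrite <- Rmult_assoc, <- Rpower_plus, Rplus_opp_l, Rpower_O, Rmult_1_l by lra.
  apply Rmult_le_compat_r; [lra|].
  assert (Hsm : sin (PI * (INR m - 1 + t)) ^ 2 = sin (PI * t) ^ 2).
  { replace (INR m - 1 + t) with (INR m - (1 - t)) by ring.
    rewrite sin_sq_PI_sub, <- sin_PI_x; do 2 f_equal; ring. }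
  rewrite Hsm.
  assert (sin (PI * alpha q) <= sin (PI * t)); [|nra].
  destruct (Rle_lt_dec t (1 / 2)).
  - apply sin_incr_1; nra.
  - rewrite <- (sin_PI_x (PI * t)); apply sin_incr_1; nra.
Qed.

(** * Close to the prime *)

Lemma sin_ge_cubic (x : R) : 0 <= x <= 2 -> x - x ^ 3 / 6 <= sin x.
Proof.
  intros Hx; pose proof PI2_1.
  destruct (sin_bound x 0) as [H1 _]; [lra|lra|].
  unfold sin_approx, sin_term in H1; simpl in H1; lra.
Qed.

Lemma sin_sq_ge (x : R) : 0 <= x <= 1 -> x ^ 2 * (1 - x ^ 2 / 3) <= sin x ^ 2.
Proof.
  intros Hx; pose proof (sin_ge_cubic x ltac:(lra)) as H.
  assert (0 <= x - x ^ 3 / 6) by nra.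
  assert ((x - x ^ 3 / 6) ^ 2 <= sin x ^ 2) by (apply pow_incr; lra).
  assert (0 <= (x ^ 3) ^ 2) by apply pow2_ge_0.
  nra.
Qed.

(** With [y = PI u], the denominator [(m sin (y / m))^2] of the kernel is at
    most [y^2], so the value is at least [(sin y / y)^2]. *)
Lemma phi_self_ge (m : nat) (u : R) :
  (5 <= m)%nat -> 0 < u <= 1 / 4 ->
  1 - (PI * u) ^ 2 / 3 <= phi m (INR m - u).
Proof.
  intros Hm Hu.
  pose proof PI_RGT_0 as Hpi; pose proof PI_4 as Hpi4.
  assert (Hp : 0 < INR m) by (apply lt_0_INR; lia).
  set (y := PI * u); assert (Hy : 0 < y <= 1) by (unfold y; nra).
  pose proof (phi_sin m (INR m - u) ltac:(lia)) as E.
  replace (sin (PI * (INR m - u) / INR m)) with (sin (y / INR m)) in E.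
  2: { rewrite <- sin_PI_x; f_equal; unfold y; field; lra. }
  rewrite sin_sq_PI_sub in E; fold y in E.
  assert (Hle : (INR m * sin (y / INR m)) ^ 2 <= y ^ 2).
  { assert (0 < y / INR m <= 1).
    { split; [apply Rdiv_lt_0_compat; lra|].
      apply Rle_div_l; [lra|].
      pose proof (le_INR 5 m Hm) as H5; simpl in H5; lra. }
    apply pow_incr; split.
    - apply Rmult_le_pos; [lra|]. apply sin_ge_0; pose proof PI2_1; lra.
    - pose proof (sin_lt_x (y / INR m) ltac:(lra)).
      replace y with (INR m * (y / INR m)) at 2 by (field; lra).
      apply Rmult_le_compat_l; lra. }
  pose proof (phi_nonneg m (INR m - u) ltac:(lia)) as Hn.
  pose proof (sin_sq_ge y ltac:(lra)) as Hs.
  assert (0 < y ^ 2) by (apply pow_lt; lra).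
  apply (Rmult_le_reg_l (y ^ 2)); [assumption|nra].
Qed.

(** With [v = ln q * u], the second factor on the left is
    [1 - v + O(y^2 v)], where [y = PI u].  Now [q^u = exp v] and
    [exp v * (1 - v) <= 1], so no term of first order in [u] remains; the error
    is bounded using [v <= (q - 1) / 4] and [q^u <= q]. *)
Lemma main_term_near (q u : R) :
  1 < q -> 0 < u <= 1 / 4 ->
  Rpower q u * (1 - ln q * (sin (2 * (PI * u)) / (2 * PI)))
  <= 1 + (PI * u) ^ 2 * (q * (q - 1) / 6).
Proof.
  intros hq Hu.
  pose proof PI_RGT_0 as Hpi; pose proof PI_4 as Hpi4.
  pose proof (ln_gt_0 q hq) as Hl; pose proof (ln_le_sub q ltac:(lra)) as Hl'.
  set (y := PI * u); assert (Hy : 0 < y <= 1) by (unfold y; nra).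
  set (v := ln q * u).
  assert (Hv : 0 < v <= (q - 1) / 4) by (unfold v; nra).
  assert (Hs : u - 2 / 3 * y ^ 2 * u <= sin (2 * y) / (2 * PI)).
  { apply Rle_div_r; [lra|].
    pose proof (sin_ge_cubic (2 * y) ltac:(lra)).
    replace ((u - 2 / 3 * y ^ 2 * u) * (2 * PI)) with (2 * y - (2 * y) ^ 3 / 6)
      by (unfold y; field).
    assumption. }
  assert (Hb : 1 - ln q * (sin (2 * y) / (2 * PI)) <= 1 - v + 2 / 3 * y ^ 2 * v).
  { unfold v; nra. }
  assert (HE : 0 < Rpower q u <= q).
  { split; [apply exp_pos|].
    rewrite <- (Rpower_1 q) at 2 by lra; apply Rle_Rpower; lra. }
  assert (Hexp : Rpower q u * (1 - v) <= 1).
  { pose proof (exp_ineq1_le (- v)) as H.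
    replace 1 with (Rpower q u * exp (- v)) at 2.
    - apply Rmult_le_compat_l; lra.
    - unfold Rpower, v; rewrite <- exp_plus, <- exp_0; f_equal; ring. }
  assert (Hv2 : Rpower q u * v <= q * ((q - 1) / 4))
    by (apply Rmult_le_compat; lra).
  assert (0 < y ^ 2) by (apply pow_lt; lra).
  nra.
Qed.

(** Near an odd [m], [phi 2] is [sin (y / 2)^2], while [phi 3] and [phi 4] are
    at least [sin y ^ 2 / 9] and [sin y ^ 2 / 16], where [y = PI u <= 1].  With
    [sin x ^ 2 >= x^2 (1 - x^2 / 3)] these three are at least [11/48], [2/27]
    and [1/24] times [y^2]; already at [q = 1] the sum of the coefficients
    exceeds the [1/3] lost by [phi m]. *)
Lemma Fsharp_pos_right (q u : R) (m : nat) :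
  1 < q -> Nat.Odd m -> (5 <= m)%nat -> 0 < u <= 1 / 4 ->
  0 < Fsharp (INR m - u) q.
Proof.
  intros hq Hodd Hm Hu; apply Fsharp_pos_of; [exact hq|].
  pose proof PI_RGT_0 as Hpi; pose proof PI_4 as Hpi4.
  pose proof (main_term_near q u hq Hu) as HR.
  pose proof (phi_self_ge m u Hm Hu) as Hself.
  pose proof (S_q_ge_terms q (INR m - u) m hq Hm) as HS.
  pose proof (phi_ge 3 (INR m - u) ltac:(lia)) as H3.
  pose proof (phi_ge 4 (INR m - u) ltac:(lia)) as H4.
  rewrite sin_sq_PI_sub in H3, H4.
  assert (H2 : phi 2 (INR m - u) = sin (PI * u / 2) ^ 2).
  { destruct Hodd as [k ->]; rewrite phi_2.
    replace (PI * (INR (2 * k + 1) - u))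
      with ((PI - 2 * (PI * u / 2)) + 2 * INR k * PI)
      by (rewrite plus_INR, mult_INR; simpl; field).
    rewrite cos_period, Rtrigo_facts.cos_pi_minus, cos_2a_sin; field. }
  set (y := PI * u) in *; assert (Hy : 0 < y <= 1) by (unfold y; nra).
  pose proof (sin_sq_ge y ltac:(lra)) as Hs1.
  pose proof (sin_sq_ge (y / 2) ltac:(lra)) as Hs2.
  rewrite <- H2 in Hs2.
  assert (Hy2 : 0 < y ^ 2 <= 1) by (split; [apply pow_lt|]; nra).
  assert (B2 : y ^ 2 * (11 / 48) <= phi 2 (INR m - u)) by nra.
  assert (B3 : y ^ 2 * (2 / 27) <= phi 3 (INR m - u)).
  { simpl INR in H3; nra. }
  assert (B4 : y ^ 2 * (1 / 24) <= phi 4 (INR m - u)).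
  { simpl INR in H4; nra. }
  assert (HS1 : S_1 (INR m - u) = - (sin (2 * y) / (2 * PI))).
  { unfold S_1.
    replace (2 * PI * (INR m - u)) with (- (2 * y) + 2 * INR m * PI)
      by (unfold y; ring).
    rewrite sin_period, sin_neg; field; lra. }
  replace (Rpower q (- (INR m - u)) * (1 + ln q * S_1 (INR m - u)))
    with (/ q ^ m * (Rpower q u * (1 - ln q * (sin (2 * y) / (2 * PI))))).
  2: { rewrite HS1, <- Rpower_pow, <- Rpower_Ropp, <- Rmult_assoc,
         <- Rpower_plus by lra.
       replace (- INR m + u) with (- (INR m - u)) by ring; ring. }
  eapply Rlt_le_trans; [|exact HS].
  assert (Hqm : 0 < q ^ m) by (apply pow_lt; lra).
  assert (Hq5 : 1 <= q ^ (m - 5)) by (apply pow_R1_Rle; lra).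
  apply (Rmult_lt_reg_l (q ^ m)); [exact Hqm|].
  rewrite <- Rmult_assoc, Rinv_r, Rmult_1_l by lra.
  replace (q ^ m * (/ q ^ 2 * phi 2 (INR m - u) + / q ^ 3 * phi 3 (INR m - u)
                    + / q ^ 4 * phi 4 (INR m - u) + / q ^ m * phi m (INR m - u)))
    with (q ^ (m - 5) * (q ^ 3 * phi 2 (INR m - u) + q ^ 2 * phi 3 (INR m - u)
                         + q * phi 4 (INR m - u)) + phi m (INR m - u)).
  2: { replace (q ^ m) with (q ^ (m - 5) * q ^ 5)
         by (rewrite <- pow_add; f_equal; lia).
       field; lra. }
  (* At q = 1 the two sides are 0.3333 and 0.3449; the right one grows faster. *)
  assert (Hpoly : 1 / 3 + q * (q - 1) / 6
                  < q ^ 3 * (11 / 48) + q ^ 2 * (2 / 27) + q * (1 / 24)) by nra.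
  set (T := q ^ 3 * phi 2 (INR m - u) + q ^ 2 * phi 3 (INR m - u)
            + q * phi 4 (INR m - u)).
  assert (HT : y ^ 2 * (q ^ 3 * (11 / 48) + q ^ 2 * (2 / 27) + q * (1 / 24)) <= T).
  { unfold T.
    assert (0 < q ^ 3) by (apply pow_lt; lra).
    assert (0 < q ^ 2) by (apply pow_lt; lra).
    nra. }
  assert (HyT : y ^ 2 * (1 / 3 + q * (q - 1) / 6) < T).
  { eapply Rlt_le_trans; [|exact HT]; apply Rmult_lt_compat_l; lra. }
  assert (0 <= T) by nra.
  assert (T <= q ^ (m - 5) * T) by nra.
  lra.
Qed.

(** * The whole interval *)

Lemma Fsharp_pos (q x : R) (m : nat) :
  1 < q -> Nat.Odd m -> P_0 q <= INR m -> INR m - 1 < x < INR m ->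
  0 < Fsharp x q.
Proof.
  intros hq Hodd HP Hx.
  pose proof (alpha_bounds q hq) as Ha.
  assert (Hm : (5 <= m)%nat).
  { apply INR_le; replace (INR 5) with 5 by (simpl; ring).
    exact (Rle_trans _ _ _ (Rmax_r _ _) (Rle_trans _ _ _ (Rmax_r _ _) HP)). }
  destruct (Rle_lt_dec x (INR m - alpha q)) as [H|H].
  - replace x with (INR m - 1 + (x - (INR m - 1))) by ring.
    destruct (Rle_lt_dec (x - (INR m - 1)) (alpha q)).
    + apply Fsharp_pos_left; auto; lra.
    + apply Fsharp_pos_middle; auto; lra.
  - replace x with (INR m - (INR m - x)) by ring.
    apply Fsharp_pos_right; auto; lra.
Qed.

Theorem theorem4p8 (q : R) (hq : 1 < q) :
  (forall p : Z, prime p -> Z.Odd p -> P_0 q <= IZR p ->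
     (forall x : R, IZR p - 1 < x < IZR p -> 0 < Fsharp x q)
     /\ Fsharp (IZR p) q = 0)
  /\ (forall p : Z, prime p -> Z.Odd p -> P_0 q <= IZR p ->
        ~ exists x : R, IZR p - 1 < x < IZR p /\ Fsharp x q = 0).
Proof.
  assert (Hmain : forall p : Z, prime p -> Z.Odd p -> P_0 q <= IZR p ->
     (forall x : R, IZR p - 1 < x < IZR p -> 0 < Fsharp x q)
     /\ Fsharp (IZR p) q = 0).
  { intros p Hp Hodd.
    pose proof (prime_ge_2 p Hp) as H2.
    rewrite <- (Z2Nat.id p) in * by lia.
    set (m := Z.to_nat p) in *; rewrite <- INR_IZR_INZ; intros HP.
    split.
    - intros x Hx; apply (Fsharp_pos q x m); auto.
      destruct Hodd as [k Hk]; exists (Z.to_nat k); lia.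
    - apply Fsharp_prime; assumption. }
  split; [exact Hmain|].
  intros p Hp Hodd HP [x [Hx H0]].
  pose proof (proj1 (Hmain p Hp Hodd HP) x Hx); lra.
Qed.
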